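(* For stochastic kernels $\mathsf{parameter}\in\mathbf{D}Z$, $\mathsf{prior}\in\mathbf{D}X$, $\mathsf{channel}\colon X\to\mathbf{D}Y$ and a partial function $\mathsf{property}\colon Y\times Z\to\mathbf{M}1$, consider the following two modes of update extending Bayes' update, interpreted in the magmad of normalized distributions with left do-notation: (i) Pearl's update: do { $z\leftarrow\mathsf{parameter}$; $x\leftarrow\mathsf{prior}$; $y\leftarrow\mathsf{channel}(x)$; $()\leftarrow\mathsf{property}(y,z)$; return $x$ }; (ii) Jeffrey's update: do { $z\leftarrow\mathsf{parameter}$; $(x,y)\leftarrow$ do { $x\leftarrow\mathsf{prior}$; $y\leftarrow\mathsf{channel}(x)$; $()\leftarrow\mathsf{property}(y,z)$; return $(x,y)$ }; return $x$ }. Pearl's and Jeffrey's updates do not coincide in general: there exist sets $X,Y,Z$ and such $\mathsf{parameter},\mathsf{prior},\mathsf{channel},\mathsf{property}$ for which the two programs denote different elements of $\mathbf{M}\mathbf{D}X$.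
   Context: $\mathbf{D}X$: finite formal sums $\sum_i\lambda_i|x_i\rangle$ with $\lambda_i>0$, $\sum_i\lambda_i=1$. $\mathbf{M}X=X+\{\bot\}$. $\mathbf{M}\mathbf{D}X$: normalized distributions, i.e. finite formal sums with total mass $1$ or $0$ (the zero sum $0$ being $\bot$). For a finite formal sum $d=\sum_i\lambda_i|x_i\rangle$ with $\lambda_i>0$ and mass at most $1$, its normalization $d^\circ$ is $\sum_i\frac{\lambda_i}{\sum_k\lambda_k}|x_i\rangle$ if $d\ne0$, and $0^\circ=0$. Elements of $\mathbf{D}X$ are regarded as elements of $\mathbf{M}\mathbf{D}X$ by inclusion, and elements of $\mathbf{M}1$ as elements of $\mathbf{M}\mathbf{D}1$ ($*\mapsto1|\rangle$, $\bot\mapsto0$), where $1$ is a one-point set. Magmad of normalized distributions: $\eta(x)=|x\rangle$, and binding $\beta(t)(f)=\big(\sum_x t(x)f(x)\big)^\circ$ for $t\in\mathbf{MD}X$, $f\colon X\to\mathbf{MD}Y$. Right do-notation: rightDo { return $\vec x$ } $=\eta(\vec x)$, and rightDo { $\vec x\leftarrow e$; rest } $=\beta(e)(\lambda\vec x.\ \text{rightDo \{ rest \}})$. Left do-notation (written do): do { $\vec x\leftarrow e_1$; $\vec y\leftarrow e_2$; rest } $=$ do { $(\vec x,\vec y)\leftarrow$ rightDo { $\vec x\leftarrow e_1$; $\vec y\leftarrow e_2$; return $(\vec x,\vec y)$ }; rest }; do { $\vec x\leftarrow e$; return $\vec y$ } $=$ rightDo { $\vec x\leftarrow e$; return $\vec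 y$ }; do { return $\vec x$ } $=\eta(\vec x)$. Expressions may depend on previously bound variables. *)

(* Defs.v *)
From mathcomp Require Import all_boot all_order all_algebra finmap reals.

Set Implicit Arguments.
Unset Strict Implicit.
Unset Printing Implicit Defensive.

Import Order.TTheory GRing.Theory Num.Theory.
Local Open Scope ring_scope.
Local Open Scope fset_scope.

(* Sets are choiceTypes and weights are elements of R : realType.  A finite
   formal sum is the finitely supported function giving its coefficients. *)

Notation fsum R X := {fsfun X%type -> R%type with 0}.

Section FormalSums.
Context {R : realType}.
Implicit Types X Y : choiceType.

Definition mass X (d : fsum R X) : R := \sum_(x <- finsupp d) d x.

Definition pos_coefs X (d : fsum R X) : bool :=
  all (fun x => 0 < d x) (finsupp d).

Lemma pos_coefs_ge0 X (d : fsum R X) : pos_coefs d -> forall x, 0 <= d x.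
Proof.
move=> /allP dP x; case: finsuppP => [//|xd].
exact/ltW/dP.
Qed.

Lemma pos_coefsP X (d : fsum R X) : (forall x, 0 <= d x) -> pos_coefs d.
Proof. by move=> d_ge0; apply/allP => x; rewrite mem_finsupp lt0r d_ge0 => ->. Qed.

Lemma massE X (d : fsum R X) (S : {fset X}) :
  finsupp d `<=` S -> mass d = \sum_(x <- S) d x.
Proof.
move=> dS; apply: big_fset_incl => // x _.
by rewrite memNfinsupp => /eqP.
Qed.

End FormalSums.

Record subdist (R : realType) (X : choiceType) := Subdist {
  subdist_sum :> fsum R X;
  subdistP : pos_coefs subdist_sum && (mass subdist_sum <= 1) }.

(* D X *)
Record dist (R : realType) (X : choiceType) := Dist {
  dist_sum :> fsum R X;
  distP : pos_coefs dist_sum && (mass dist_sum == 1) }.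

(* MD X *)
Record mdist (R : realType) (X : choiceType) := MDist {
  mdist_sum :> fsum R X;
  mdistP : pos_coefs mdist_sum &&
           ((mass mdist_sum == 0) || (mass mdist_sum == 1)) }.

Section Normalized.
Context {R : realType}.
Implicit Types X Y : choiceType.

Definition bot X : mdist R X.
Proof.
by exists [fsfun]; rewrite /pos_coefs /mass finsupp0 big_seq_fset0 eqxx.
Defined.

Definition mdist_of_dist X (d : dist R X) : mdist R X.
Proof. by exists (dist_sum d); have /andP[-> ->] := distP d; rewrite orbT. Defined.

(* When d = 0 the support is empty, so no division takes place. *)
Definition normalize_sum X (d : fsum R X) : fsum R X :=
  [fsfun x in finsupp d => d x / mass d].

Lemma normalizeP X (d : subdist R X) :
  pos_coefs (normalize_sum d) &&
  ((mass (normalize_sum d) == 0) || (mass (normalize_sum d) == 1)).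
Proof.
have /andP[/pos_coefs_ge0 d_ge0 _] := subdistP d.
have m_ge0 : 0 <= mass d by apply: sumr_ge0.
apply/andP; split.
  apply: pos_coefsP => x; rewrite fsfunE; case: ifP => // _.
  by rewrite divr_ge0.
have -> : mass (normalize_sum d) = mass d / mass d.
  rewrite (massE (S := finsupp d)); last first.
    by apply/fsubsetP => x; rewrite mem_finsupp fsfunE; case: ifP; rewrite ?eqxx.
  rewrite {2}/mass mulr_suml big_seq [RHS]big_seq.
  by apply: eq_bigr => x xd; rewrite fsfunE xd.
have [->|m_neq0] := eqVneq (mass d) 0; first by rewrite mul0r eqxx.
by rewrite divff // eqxx orbT.
Qed.

Definition normalize X (d : subdist R X) : mdist R X := MDist (normalizeP d).

Definition mix_sum X Y (t : mdist R X) (f : X -> mdist R Y) : fsum R Y :=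
  [fsfun y in \bigcup_(x <- finsupp t) finsupp (f x) =>
     \sum_(x <- finsupp t) t x * f x y].

Lemma mixP X Y (t : mdist R X) (f : X -> mdist R Y) :
  pos_coefs (mix_sum t f) && (mass (mix_sum t f) <= 1).
Proof.
have /andP[/pos_coefs_ge0 t_ge0 t01] := mdistP t.
have f_ge0 x : forall y, 0 <= f x y.
  by have /andP[/pos_coefs_ge0] := mdistP (f x).
apply/andP; split.
  apply: pos_coefsP => y; rewrite fsfunE; case: ifP => // _.
  by apply: sumr_ge0 => x _; rewrite mulr_ge0.
pose S := \bigcup_(x <- finsupp t) finsupp (f x).
have -> : mass (mix_sum t f) = \sum_(x <- finsupp t) t x * mass (f x).
  rewrite (massE (S := S)); last first.
    apply/fsubsetP => y; rewrite mem_finsupp fsfunE.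
    by case: ifP; rewrite ?eqxx.
  transitivity (\sum_(y <- S) \sum_(x <- finsupp t) t x * f x y).
    by rewrite big_seq [RHS]big_seq; apply: eq_bigr => y yS; rewrite fsfunE yS.
  rewrite exchange_big /= big_seq [RHS]big_seq; apply: eq_bigr => x xt.
  by rewrite -mulr_sumr (massE (S := S)) //; apply: bigfcup_sup.
apply: (@le_trans _ _ (mass t)); last by case/orP: t01 => /eqP ->; rewrite ?ler01.
apply: ler_sum => x _; rewrite ler_piMr //.
by have /andP[_ /orP[] /eqP ->] := mdistP (f x); rewrite ?ler01.
Qed.

Definition mix X Y (t : mdist R X) (f : X -> mdist R Y) : subdist R Y :=
  Subdist (mixP t f).

(* The magmad of normalized distributions. *)

Definition eta X (x : X) : mdist R X.
Proof.
exists [fsfun z in [fset x] => 1].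
have s1 : finsupp ([fsfun z in [fset x] => 1] : fsum R X) = [fset x].
  apply/fsetP => z; rewrite mem_finsupp fsfunE.
  by case: ifP => _; rewrite ?oner_eq0 ?eqxx.
rewrite /pos_coefs /mass s1 big_seq_fset1 fsfunE in_fset1 eqxx eqxx orbT andbT.
by apply/allP => z zx; rewrite fsfunE zx ltr01.
Defined.

Definition beta X Y (t : mdist R X) (f : X -> mdist R Y) : mdist R Y :=
  normalize (mix t f).

(* M X = option X *)
Definition mdist_of_partial X (o : option X) : mdist R X :=
  if o is Some x then eta x else bot X.

End Normalized.

(* Do-blocks.  [block C B] is the part of a block with result in B that comes
   after the variables c : C have been bound.  Tuples of variables are
   left-nested pairs, so that the expressions of a block are functions of
   (x1, ..., xn).  Variables bound outside the block are Rocq variables. *)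
Inductive block (R : realType) (B : choiceType) : choiceType -> Type :=
| Return (C : choiceType) (v : C -> B) : block R B C
| Bind (C A : choiceType) (e : C -> mdist R A)
    (rest : block R B (C * A)%type) : block R B C.

Inductive program (R : realType) (B : choiceType) : Type :=
| PReturn (v : B)
| PBind (A : choiceType) (e : mdist R A) (rest : block R B A).

Arguments Return {R B C} v.
Arguments Bind {R B C A} e rest.
Arguments PReturn {R B} v.
Arguments PBind {R B A} e rest.

Section Do.
Context {R : realType}.

Fixpoint right_block (B C : choiceType) (p : block R B C) : C -> mdist R B :=
  match p with
  | Return _ v => fun c => eta (v c)
  | Bind _ _ e rest => fun c => beta (e c) (fun a => right_block rest (c, a))
  end.

Definition rightDo (B : choiceType) (p : program R B) : mdist R B :=
  match p with
  | PReturn v => eta v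
  | PBind _ e rest => beta e (right_block rest)
  end.

(* [left_block p e1] is the left do of the program  c <- e1; p. *)
Fixpoint left_block (B C : choiceType) (p : block R B C) :
    mdist R C -> mdist R B :=
  match p with
  | Return _ v => fun e1 => rightDo (PBind e1 (Return v))
  | Bind _ _ e2 rest => fun e1 =>
      left_block rest (rightDo (PBind e1 (Bind e2 (Return id))))
  end.

Definition leftDo (B : choiceType) (p : program R B) : mdist R B :=
  match p with
  | PReturn v => eta v
  | PBind _ e rest => left_block rest e
  end.

End Do.

Section Updates.
Context {R : realType} {X Y Z : choiceType}.
Variables (parameter : dist R Z) (prior : dist R X) (channel : X -> dist R Y)
  (property : Y * Z -> option unit).

Definition pearl_update : mdist R X :=
  leftDo (
    PBind (*  z <- *) (mdist_of_dist parameter) (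
    Bind  (*  x <- *) (fun z => mdist_of_dist prior) (
    Bind  (*  y <- *) (fun '(z, x) => mdist_of_dist (channel x)) (
    Bind  (* () <- *) (fun '(z, x, y) => mdist_of_partial (property (y, z))) (
    Return (fun '(z, x, y, tt) => x)))))).

Definition jeffrey_update : mdist R X :=
  leftDo (
    PBind (*      z <- *) (mdist_of_dist parameter) (
    Bind  (* (x, y) <- *) (fun z => leftDo (
      PBind (*  x <- *) (mdist_of_dist prior) (
      Bind  (*  y <- *) (fun x => mdist_of_dist (channel x)) (
      Bind  (* () <- *) (fun '(x, y) => mdist_of_partial (property (y, z))) (
      Return (fun '(x, y, tt) => (x, y))))))) (
    Return (fun '(z, (x, y)) => x)))).

End Updates.

(* Main.v *)
Require Import Defs.
From mathcomp Require Import all_boot all_order all_algebra finmap reals.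
From mathcomp Require Import ring lra.

(** A line of a left do-block that draws from a distribution loses no mass, so
    that normalization acts only where mass is lost, which starts at the
    observation [property]. What matters is therefore which variables have been
    drawn, in the block that contains the observation, when it is made.

    Given a parameter [z], let [success z x] be the mass of the outcomes that
    draw [x] and pass the observation, [evidence z] its total over [x], and
    [posterior z x] their quotient. Pearl's update makes the observation in the
    block that draws [z], so that success is averaged over [z] and divided by
    the overall evidence [pearl_updateE]. Jeffrey's update makes it in an inner
    block, where [z] is fixed, so that it averages the posteriors themselves,
    over the [z] that have nonzero evidence [jeffrey_updateE]. Since [success z
    x = evidence z * posterior z x], Pearl's update reweighs each [z] by its
    evidence and Jeffrey's does not. They can differ when both the evidence and
    the posterior depend on [z].

    A small situation of this kind has a fair coin [z], a fair coin [x], a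
    noiseless channel, and the property [z ==> y]. Three of the four equally
    likely pairs [(z, x)] survive and two of them have [x = true], so Pearl's
    update gives [2/3] to [true]. Jeffrey's update averages the posteriors [1]
    and [1/2] and gives [3/4]. *)

Set Implicit Arguments.
Unset Strict Implicit.
Unset Printing Implicit Defensive.

Import Order.TTheory GRing.Theory Num.Theory.
Local Open Scope ring_scope.

(** * Formal sums over finite sets *)

Section Finite.
Context {R : realType}.
Implicit Types X Y : finType.

Lemma mass_fin X (d : fsum R X) : mass d = \sum_x d x.
Proof.
rewrite /mass big_uniq ?fset_uniq //= big_mkcond; apply: eq_bigr => x _.
by rewrite mem_finsupp; case: eqP => //= ->.
Qed.

Lemma mix_sum_fin X Y (t : mdist R X) (f : X -> mdist R Y) y :
  mix_sum t f y = \sum_x t x * f x y.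
Proof.
have supp : \sum_(x <- finsupp t) t x * f x y = \sum_x t x * f x y.
  rewrite big_uniq ?fset_uniq //= big_mkcond; apply: eq_bigr => x _.
  by rewrite mem_finsupp; case: eqP => //= ->; rewrite mul0r.
rewrite fsfunE; case: ifPn => // yS; rewrite -supp big_seq big1 // => x xt.
case: (finsuppP (f x) y) => [|yf]; first by rewrite mulr0.
by case/negP: yS; apply/bigfcupP; exists x; rewrite ?xt.
Qed.

Lemma normalize_sumE X (d : fsum R X) x : normalize_sum d x = d x / mass d.
Proof. by rewrite fsfunE; case: finsuppP => //; rewrite mul0r. Qed.

(** The denominator is the mass of the mixture, with the two sums exchanged: it
    is 1 as soon as neither [t] nor any [f x] loses mass. *)
Lemma betaE X Y (t : mdist R X) (f : X -> mdist R Y) y :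
  beta t f y =
  (\sum_x t x * f x y) / \sum_x t x * mass (f x).
Proof.
rewrite [LHS]normalize_sumE [mix _ _ _]mix_sum_fin mass_fin; congr (_ / _).
rewrite (eq_bigr _ (fun y _ => mix_sum_fin t f y)).
rewrite exchange_big; apply: eq_bigr => x _.
by rewrite mass_fin mulr_sumr.
Qed.

Lemma etaE X (x y : X) : eta (R := R) x y = (y == x)%:R.
Proof. by rewrite fsfunE in_fset1; case: eqP. Qed.

Lemma mass_eta X (x : X) : mass (eta (R := R) x) = 1.
Proof.
rewrite mass_fin (bigD1 x) //= etaE eqxx big1 ?addr0 // => y /negbTE yx.
by rewrite etaE yx.
Qed.

(** When the mass is 0, so are all the coefficients, and both sides vanish. *)
Lemma mdist_divmass X (t : mdist R X) x : t x / mass t = t x.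
Proof.
have /andP[/pos_coefs_ge0 t_ge0 /orP[] /eqP t01] := mdistP t; last first.
  by rewrite t01 divr1.
suff -> : t x = 0 by rewrite mul0r.
by move: t01; rewrite mass_fin => /psumr_eq0P ->.
Qed.

(** Returning a function of the bound variables only takes a marginal: the
    normalization in the bind has nothing left to do. *)
Lemma beta_etaE X Y (t : mdist R X) (g : X -> Y) y :
  beta t (fun x => eta (g x)) y = \sum_(x | g x == y) t x.
Proof.
rewrite betaE [X in _ / X](eq_bigr t) => [|x _];
  last by rewrite mass_eta mulr1.
rewrite -mass_fin mulr_suml [RHS]big_mkcond; apply: eq_bigr => x _.
rewrite mulrAC mdist_divmass etaE eq_sym.
by case: eqP; rewrite ?mulr1 ?mulr0.
Qed.

Lemma mass_beta_eta X Y (t : mdist R X) (g : X -> Y) :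
  mass (beta t (fun x => eta (g x))) = mass t.
Proof.
rewrite !mass_fin [RHS](partition_big g xpredT) //=.
by apply: eq_bigr => y _; rewrite beta_etaE.
Qed.

End Finite.

(** * Joint distributions

    A left do-block is a chain of [joint] followed by a marginal. *)

Section Joint.
Context {R : realType}.
Implicit Types X Y : finType.

(** The inner step by which left do-notation merges two lines into one. *)
Definition joint X Y (t : mdist R X) (f : X -> mdist R Y) :
    mdist R (X * Y)%type :=
  rightDo (PBind t (Bind f (Return id))).

Lemma jointE X Y (t : mdist R X) (f : X -> mdist R Y) x y :
  joint t f (x, y) = t x * f x y / \sum_x' t x' * mass (f x').
Proof.
rewrite /joint /= betaE; congr (_ / _); last first.
  by apply: eq_bigr => x' _; rewrite mass_beta_eta.
rewrite (bigD1 x) //= big1 ?addr0 => [|x' /negbTE x'x].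
  rewrite beta_etaE (big_pred1 y) // => y'.
  by rewrite xpair_eqE eqxx.
rewrite beta_etaE big_pred0 ?mulr0 // => y'.
by rewrite xpair_eqE x'x.
Qed.

Lemma joint_totalE X Y (t : mdist R X) (f : X -> mdist R Y) x y :
  mass t = 1 -> (forall x, mass (f x) = 1) -> joint t f (x, y) = t x * f x y.
Proof.
move=> t1 f1; rewrite jointE [X in _ / X](eq_bigr t) => [|x' _];
  last by rewrite f1 mulr1.
by rewrite -mass_fin t1 divr1.
Qed.

Lemma sum_pair X Y (F : X * Y -> R) :
  \sum_p F p = \sum_x \sum_y F (x, y).
Proof. by rewrite pair_bigA; apply: eq_bigr => -[]. Qed.

Lemma sum_unit (F : unit -> R) : \sum_u F u = F tt.
Proof. by rewrite (bigD1 tt) //= big1 ?addr0 // => -[]. Qed.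

Lemma mass_joint_total X Y (t : mdist R X) (f : X -> mdist R Y) :
  mass t = 1 -> (forall x, mass (f x) = 1) -> mass (joint t f) = 1.
Proof.
move=> t1 f1; rewrite mass_fin sum_pair -t1 mass_fin; apply: eq_bigr => x _.
under eq_bigr do rewrite joint_totalE //.
by rewrite -mulr_sumr -mass_fin f1 mulr1.
Qed.

Lemma mass_of_dist X (d : dist R X) : mass (mdist_of_dist d) = 1.
Proof. by have /andP[_ /eqP] := distP d. Qed.

Lemma partialE (o : option unit) :
  mdist_of_partial (R := R) o tt = (isSome o)%:R.
Proof. by case: o => [[]|] /=; rewrite ?etaE ?fsfunE. Qed.

Lemma mass_partial (o : option unit) :
  mass (mdist_of_partial (R := R) o) = (isSome o)%:R.
Proof. by rewrite mass_fin sum_unit partialE. Qed.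

End Joint.

(** * The two updates over finite sets *)

Section Updates.
Context {R : realType} {X Y Z : finType}.
Variables (parameter : dist R Z) (prior : dist R X) (channel : X -> dist R Y)
  (property : Y * Z -> option unit).

Definition weight z x y : R :=
  prior x * channel x y * (isSome (property (y, z)))%:R.

Definition success z x : R := \sum_y weight z x y.

Definition evidence z : R := \sum_x success z x.

(** If the evidence is 0, this is 0 for all [x], like the coefficients of [bot]. *)
Definition posterior z x : R := success z x / evidence z.

Let prior1 := mass_of_dist prior.
Let parameter1 := mass_of_dist parameter.
Let channel1 x := mass_of_dist (channel x).

(** Only the last of the three joint distributions has a denominator, because
    the first two draw from distributions of mass 1. *)
Lemma pearl_updateE x :
  pearl_update parameter prior channel property x =
  (\sum_z parameter z * success z x) /
  \sum_z parameter z * evidence z.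
Proof.
pose t2 := joint (mdist_of_dist parameter) (fun=> mdist_of_dist prior).
pose t3 := joint t2 (fun '(z, x) => mdist_of_dist (channel x)).
pose t4 := joint t3 (fun '(z, x, y) => mdist_of_partial (property (y, z))).
have t3E z x' y : t3 (z, x', y) = parameter z * prior x' * channel x' y.
  rewrite joint_totalE; [|exact: mass_joint_total|by case].
  by rewrite joint_totalE.
(* Named so that the returned value is a function applied to the whole tuple,
   as [beta_etaE] expects. *)
pose result : Z * X * Y * unit -> X := fun '(z, x, y, tt) => x.
rewrite -[pearl_update _ _ _ _]/(beta t4 (fun p => eta (result p))).
rewrite beta_etaE big_mkcond !sum_pair mulr_suml; apply: eq_bigr => z _.
rewrite (bigD1 x) //= [X in _ + X]big1 ?addr0 => [|x' /negbTE x'x]; last first.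
  by apply: big1 => y _; rewrite sum_unit /= x'x.
rewrite mulr_sumr mulr_suml; apply: eq_bigr => y _.
rewrite sum_unit /= eqxx jointE t3E partialE; congr (_ / _).
  by rewrite /weight !mulrA.
rewrite !sum_pair; apply: eq_bigr => z' _; rewrite mulr_sumr.
apply: eq_bigr => x' _; rewrite mulr_sumr; apply: eq_bigr => y' _.
by rewrite t3E mass_partial /weight !mulrA.
Qed.

(** The denominator is the weight of the parameters that have nonzero evidence:
    a [z] without a posterior is discarded by the normalization in the line that
    binds the inner block. *)
Lemma jeffrey_updateE x :
  jeffrey_update parameter prior channel property x =
  (\sum_z parameter z * posterior z x) /
  \sum_z parameter z * \sum_x' posterior z x'.
Proof.
pose t2 := joint (mdist_of_dist prior) (fun x => mdist_of_dist (channel x)).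
pose t3 z := joint t2 (fun '(x, y) => mdist_of_partial (property (y, z))).
pose inner_result : X * Y * unit -> X * Y := fun '(x, y, tt) => (x, y).
pose inner z := beta (t3 z) (fun p => eta (inner_result p)).
have innerE z x' y : inner z (x', y) = weight z x' y / evidence z.
  rewrite /inner beta_etaE (big_pred1 (x', y, tt)); last first.
    by case=> [[? ?] []]; rewrite /= [RHS]xpair_eqE andbT.
  rewrite jointE joint_totalE // partialE; congr (_ / _).
  rewrite sum_pair; apply: eq_bigr => x'' _; apply: eq_bigr => y' _.
  by rewrite joint_totalE // mass_partial.
pose result : Z * (X * Y) -> X := fun '(z, (x, y)) => x.
rewrite -[jeffrey_update _ _ _ _]/(beta (joint (mdist_of_dist parameter) inner)
  (fun p => eta (result p))).
rewrite beta_etaE big_mkcond !sum_pair mulr_suml; apply: eq_bigr => z _.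
rewrite sum_pair (bigD1 x) //= [X in _ + X]big1 ?addr0 => [|x' /negbTE x'x];
  last by apply: big1 => y _; rewrite x'x.
rewrite /posterior !mulr_suml mulr_sumr mulr_suml; apply: eq_bigr => y _.
rewrite eqxx jointE innerE; congr (_ / _).
apply: eq_bigr => z' _; rewrite mass_fin sum_pair; congr (_ * _).
apply: eq_bigr => x' _; rewrite mulr_suml.
by apply: eq_bigr => y' _; rewrite innerE.
Qed.

End Updates.

(** * The counterexample *)

Section DistOfFun.
Context {R : realType} {X : finType}.
Variable f : X -> R.
Hypothesis f_ge0 : forall x, 0 <= f x.
Hypothesis f_sum1 : \sum_x f x = 1.

Let f_fsum : fsum R X := [fsfun x in [fset x | x in X]%fset => f x].

Let f_fsumE x : f_fsum x = f x.
Proof. by rewrite fsfunE in_fset. Qed.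

Lemma dist_of_fun_subproof : pos_coefs f_fsum && (mass f_fsum == 1).
Proof.
rewrite pos_coefsP => [|x]; last by rewrite f_fsumE.
by rewrite mass_fin (eq_bigr _ (fun x _ => f_fsumE x)) f_sum1 eqxx.
Qed.

Definition dist_of_fun : dist R X := Dist dist_of_fun_subproof.

Lemma dist_of_funE x : dist_of_fun x = f x.
Proof. exact: f_fsumE. Qed.

End DistOfFun.

Section Counterexample.
Context {R : realType}.

Lemma coin_ge0 (b : bool) : 0 <= 2^-1 :> R.
Proof. by rewrite invr_ge0. Qed.

Lemma coin_sum1 : \sum_(b : bool) 2^-1 = 1 :> R.
Proof. by rewrite big_bool /=; field. Qed.

Definition coin : dist R bool := dist_of_fun coin_ge0 coin_sum1.

Lemma dirac_ge0 (x y : bool) : 0 <= (y == x)%:R :> R.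
Proof. exact: ler0n. Qed.

Lemma dirac_sum1 (x : bool) : \sum_y (y == x)%:R = 1 :> R.
Proof. by rewrite big_bool; case: x; rewrite /= ?addr0 ?add0r. Qed.

Definition dirac x : dist R bool := dist_of_fun (dirac_ge0 x) (dirac_sum1 x).

Definition implication : bool * bool -> option unit :=
  fun '(y, z) => if z ==> y then Some tt else None.

Let weightE z x y :
  weight coin dirac implication z x y = 2^-1 * (y == x)%:R * (z ==> y)%:R.
Proof. by rewrite /weight !dist_of_funE /=; case: (z ==> y). Qed.

Let successE z x :
  success coin dirac implication z x = 2^-1 * (z ==> x)%:R.
Proof.
rewrite /success big_bool !weightE.
by case: x z => [] [] /=; rewrite !(mulr0, mulr1, addr0, add0r).
Qed.

Let evidenceE z :
  evidence coin dirac implication z = if z then 2^-1 else 1.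
Proof.
by rewrite /evidence big_bool !successE; case: z => /=; field.
Qed.

Lemma pearl_counterexample :
  pearl_update coin coin dirac implication true = 2 / 3.
Proof.
rewrite pearl_updateE !big_bool !evidenceE !successE !dist_of_funE /=.
by field.
Qed.

Lemma jeffrey_counterexample :
  jeffrey_update coin coin dirac implication true = 3 / 4.
Proof.
rewrite jeffrey_updateE !big_bool /posterior !evidenceE !successE.
by rewrite !dist_of_funE /=; field.
Qed.

End Counterexample.

Theorem proposition4p18 (R : realType) :
  exists (X Y Z : choiceType)
    (parameter : dist R Z) (prior : dist R X) (channel : X -> dist R Y)
    (property : Y * Z -> option unit),
    pearl_update parameter prior channel property <>
    jeffrey_update parameter prior channel property.
Proof.
exists bool, bool, bool, coin, coin, dirac, implication => same.
have := pearl_counterexample (R := R); rewrite same jeffrey_counterexample.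
by lra.
Qed.
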